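(* Let $M$ be a left $R$-module that is projective in $\sigma[M]$ and semiprime. If $M$ satisfies ACC on annihilators, then: (i) $M$ has only finitely many submodules that are minimal prime in $M$. (ii) If $P_1,P_2,\dots,P_n$ are the minimal prime in $M$ submodules, then $P_1\cap P_2\cap\cdots\cap P_n=0$. (iii) If $P\subseteq M$ is prime in $M$, then $P$ is minimal prime in $M$ if and only if $P$ is an annihilator submodule of $M$.
   Context: $R$ is an associative ring with unity; modules are unitary left $R$-modules. For a left $R$-module $M$, a module $X$ is $M$-generated if it is an epimorphic image of a direct sum of copies of $M$, and $\sigma[M]$ is the full subcategory of left $R$-modules isomorphic to a submodule of an $M$-generated module. $M$ is projective in $\sigma[M]$ if $\mathrm{Hom}_R(M,-)$ is exact on short exact sequences in $\sigma[M]$. A submodule $N\subseteq M$ is fully invariant if $f(N)\subseteq N$ for all $f\in \mathrm{End}_R(M)$. For submodules $K,L$ of $M$, $K_ML=\sum\{f(K)\mid f\in \mathrm{Hom}_R(M,L)\}$. A fully invariant submodule $N\neq M$ is prime in $M$ if for all fully invariant submodules $K,L$ of $M$, $K_ML\subseteq N$ implies $K\subseteq N$ or $L\subseteq N$; it is semiprime in $M$ if for every fully invariant submodule $K$ of $M$, $K_MK\subseteq N$ implies $K\subseteq N$. $M$ is a semiprime module if $0$ is semiprime in $M$ (in particular $M\ne 0$). A minimal prime in $M$ is a submodule prime in $M$ that is minimal under inclusion among the submodules prime in $M$; ''the minimal primes $P_1,\dots,P_n$'' means the complete list without repetition. For a module $X$ in $\sigma[M]$, $\mathrm{Ann}_M(X)=\bigcap\{\ker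 f\mid f\in \mathrm{Hom}_R(M,X)\}$. A submodule $N$ of $M$ is an annihilator submodule if $N=\mathrm{Ann}_M(K)$ for some submodule $K\subseteq M$. $M$ satisfies ACC on annihilators if the set $\{\bigcap_{f\in X}\ker f\mid X\subseteq \mathrm{End}_R(M)\}$ satisfies the ascending chain condition. *)

(* Defs.v *)
From HB Require Import structures.
From mathcomp Require Import all_boot all_order all_algebra.
From mathcomp Require Import all_classical.

Set Implicit Arguments.
Unset Strict Implicit.
Unset Printing Implicit Defensive.

Import GRing.Theory.

Local Open Scope classical_set_scope.
Local Open Scope ring_scope.

Section Submodules.
Variables (R : pzRingType) (V : lmodType R).

Record submod := Submod {
  submod_set :> set V;
  submod_setP : submod_closed (mem submod_set) }.

Lemma submod_eqP (N N' : submod) : N = N' <-> N = N' :> set V.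
Proof.
split=> [->//|]; case: N N' => [A clA] [B clB] /= eAB.
by case: B / eAB clB => clB; congr Submod; exact: Prop_irrelevance.
Qed.

Lemma submod0_subproof : submod_closed (mem ([set 0] : set V)).
Proof.
by split=> [|a u v]; rewrite !inE /= => // -> ->; rewrite scaler0 addr0.
Qed.
Definition submod0 : submod := Submod submod0_subproof.

Definition submod_pred (N : submod) : {pred V} := mem (submod_set N).

HB.instance Definition _ (N : submod) :=
  GRing.isSubmodClosed.Build R V (submod_pred N) (submod_setP N).

Record submod_type (N : submod) :=
  SubmodType { submod_val : V; _ : submod_val \in submod_pred N }.

HB.instance Definition _ (N : submod) := [isSub for @submod_val N].
HB.instance Definition _ (N : submod) := [Choice of submod_type N by <:].
HB.instance Definition _ (N : submod) :=
  [SubChoice_isSubZmodule of submod_type N by <:].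
HB.instance Definition _ (N : submod) :=
  [SubZmodule_isSubLmodule of submod_type N by <:].

End Submodules.

Section Sigma.
Variables (R : pzRingType) (M : lmodType R).

(* The direct sum of copies of [M] indexed by [I]: the submodule of the product
   module [I -> M] consisting of the finitely supported families. *)
Lemma dsum_subproof (I : Type) :
  submod_closed
    (mem ([set f | finite_set [set i | f i != 0]] : set (I -> M))).
Proof.
split=> [|a u v]; rewrite !inE /=.
  by apply: (sub_finite_set _ (@finite_set0 I)) => i /=; rewrite eqxx.
move=> fu fv; apply: (@sub_finite_set _ _
  ([set i | u i != 0] `|` [set i | v i != 0])); last by rewrite finite_setU.
move=> i /= nz; have [u0|?] := eqVneq (u i) 0; last by left.
right; apply: contra_neq nz => v0.
by rewrite -[LHS]/(a *: u i + v i) u0 v0 scaler0 addr0.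
Qed.
Definition dsum (I : Type) : lmodType R :=
  submod_type (Submod (dsum_subproof I)).

Definition generated (X : lmodType R) : Prop :=
  exists (I : Type) (f : {linear dsum I -> X}), forall x, exists s, f s = x.

Definition sigma (X : lmodType R) : Prop :=
  exists2 Y : lmodType R, generated Y &
    exists f : {linear X -> Y}, injective f.

(* 0 -> A -> B -> C -> 0 *)
Definition short_exact (A B C : lmodType R)
    (f : {linear A -> B}) (g : {linear B -> C}) : Prop :=
  [/\ injective f,
      forall b, g b = 0 <-> exists a, f a = b &
      forall c, exists b, g b = c].

(* 0 -> Hom(M, A) -> Hom(M, B) -> Hom(M, C) -> 0 *)
Definition hom_short_exact (A B C : lmodType R)
    (f : {linear A -> B}) (g : {linear B -> C}) : Prop :=
  [/\ forall h k : {linear M -> A}, f \o h =1 f \o k -> h =1 k,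
      forall h : {linear M -> B},
        (forall m, g (h m) = 0) <-> exists k : {linear M -> A}, f \o k =1 h &
      forall h : {linear M -> C}, exists k : {linear M -> B}, g \o k =1 h].

Definition projective_in_sigma : Prop :=
  forall (A B C : lmodType R) (f : {linear A -> B}) (g : {linear B -> C}),
    sigma A -> sigma B -> sigma C ->
    short_exact f g -> hom_short_exact f g.

End Sigma.

Section Primes.
Variables (R : pzRingType) (M : lmodType R).

Definition fully_invariant (N : submod M) : Prop :=
  forall f : {linear M -> M}, f @` N `<=` N.

(* The product K_M L = \sum_f f(K), as the set of finite sums of elements of the submodules
   f(K), f in Hom(M, L). *)
Definition prodM (K L : submod M) : set M :=
  [set x | exists (n : nat) (f : 'I_n -> {linear M -> submod_type L})
             (k : 'I_n -> M),
       (forall i, submod_set K (k i)) /\ x = \sum_(i < n) submod_val (f i (k i))].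

Definition prime_in (N : submod M) : Prop :=
  [/\ fully_invariant N, N <> setT :> set M &
      forall K L : submod M, fully_invariant K -> fully_invariant L ->
        prodM K L `<=` N -> K `<=` N \/ L `<=` N].

Definition semiprime_in (N : submod M) : Prop :=
  [/\ fully_invariant N, N <> setT :> set M &
      forall K : submod M, fully_invariant K ->
        prodM K K `<=` N -> K `<=` N].

Definition semiprime_module : Prop := semiprime_in (submod0 M).

Definition minimal_prime_in (P : submod M) : Prop :=
  prime_in P /\ forall Q : submod M, prime_in Q -> Q `<=` P -> Q = P.

Definition lker (X : lmodType R) (f : {linear M -> X}) : set M :=
  [set m | f m = 0].

Definition Ann (X : lmodType R) : set M :=
  \bigcap_(f in [set: {linear M -> X}]) lker f.

Definition annihilator_submod (N : submod M) : Prop :=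
  exists K : submod M, N = Ann (submod_type K) :> set M.

Definition acc_annihilators : Prop :=
  forall A : nat -> set M,
    (forall i, exists X : set {linear M -> M}, A i = \bigcap_(f in X) lker f) ->
    (forall i, A i `<=` A i.+1) ->
    exists n, forall m, (n <= m)%N -> A m = A n.

End Primes.

(* Main.v *)
Require Import Defs.
From Stdlib Require List.
From HB Require Import structures.
From mathcomp Require Import all_boot all_order all_algebra.
From mathcomp Require Import finmap all_classical.

Set Implicit Arguments.
Unset Strict Implicit.
Unset Printing Implicit Defensive.

Import GRing.Theory.

Local Open Scope classical_set_scope.
Local Open Scope ring_scope.

(** Write [ann U] for the common kernel of the endomorphisms of [M] whose image
    lies in [U]; this is Ann_M(U).

    In a semiprime module the product and the intersection of fully invariant
    submodules vanish together: K_M L lies in the intersection of K and L, and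
    conversely the square of that intersection lies in K_M L.  Hence [ann U] is
    the pseudocomplement of [U] in the lattice of fully invariant submodules
    ([sub_annP]), and the theorem becomes a statement about that lattice.

    Call a nonzero fully invariant [U] uniform when every nonzero fully
    invariant submodule of [U] has the same annihilator as [U].  Then [ann U]
    is prime: if K_M L lies in [ann U] and L does not, the intersection W of L
    and U is nonzero, K annihilates W, and [ann W] equals [ann U]
    ([uniform_prime]).  A prime of the form [ann U] is always minimal: a prime Q
    contained in it contains the zero intersection of [ann U] and U, hence
    contains [ann U], since it cannot contain U ([ann_minimal_prime]).

    The chain condition gives a uniform submodule below every nonzero fully
    invariant one.  It is used once more to choose, among the finite
    intersections of annihilators of uniform submodules, one whose own
    annihilator is maximal; this intersection is zero, as otherwise it contains
    a uniform U, and intersecting further with [ann U] enlarges the annihilator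
    by U ([uniform_anns_meet0]).  So finitely many annihilator primes have zero
    intersection.  Every prime contains their intersection, hence one of them,
    and therefore they are exactly the minimal primes.  This gives (i), (ii) and
    one half of (iii).

    For the other half, a prime P = Ann_M(K) comes with a submodule K that is
    perhaps not fully invariant.  Projectivity replaces it by one that is: let
    T be the sum of the images of the endomorphisms killing P.  A map from M to
    T lifts to the direct sum of copies of M that covers T, and since P is fully
    invariant the lift keeps P inside the summands' copies of P, where it dies.
    So P = [ann T] ([ann_of_fully_invariant]), and P is minimal. *)

(** * Submodules and linear maps into them *)

Section SubmoduleBasics.
Variables (R : pzRingType) (V : lmodType R).
Implicit Types N K : submod V.

Lemma submod_mem0 N : submod_set N 0.
Proof. by have [] := submod_setP N; rewrite inE. Qed.

Lemma submod_sum N (I : Type) (r : seq I) (F : I -> V) :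
  (forall i, submod_set N (F i)) -> submod_set N (\sum_(i <- r) F i).
Proof.
move=> NF; rewrite -inE; apply: (rpred_sum (S := submod_pred N)) => i _.
by rewrite inE.
Qed.

Lemma submodI_subproof N K : submod_closed (mem (N `&` K : set V)).
Proof.
have [N0 Nlin] := submod_setP N; have [K0 Klin] := submod_setP K.
rewrite !inE in N0 K0; split; first by rewrite inE.
move=> a u v; rewrite !inE => -[Nu Ku] [Nv Kv].
by split; rewrite -inE; [apply: Nlin|apply: Klin]; rewrite inE.
Qed.
Definition submodI N K : submod V := Submod (submodI_subproof N K).

Lemma submodT_subproof : submod_closed (mem [set: V]).
Proof. by split=> [|a u v]; rewrite !inE. Qed.
Definition submodT : submod V := Submod submodT_subproof.

Lemma range_subproof (W : lmodType R) (g : {linear W -> V}) :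
  submod_closed (mem (range g)).
Proof.
split=> [|a u v]; rewrite !inE.
  by exists 0 => //; rewrite linear0.
by move=> [x _ <-] [y _ <-]; exists (a *: x + y) => //; rewrite linearP.
Qed.
Definition range_submod (W : lmodType R) (g : {linear W -> V}) : submod V :=
  Submod (range_subproof g).

Lemma preimage_subproof (W : lmodType R) (g : {linear W -> V}) N :
  submod_closed (mem (g @^-1` N)).
Proof.
have [N0 Nlin] := submod_setP N; split=> [|a u v]; rewrite !inE /=.
  by rewrite linear0 -inE.
by move=> gu gv; rewrite linearP -inE; apply: Nlin; rewrite inE.
Qed.
Definition preimage_submod (W : lmodType R) (g : {linear W -> V}) N :
  submod W := Submod (preimage_subproof g N).

Lemma submod_valP N (x : submod_type N) : submod_set N (submod_val x).
Proof. by case: x => x /= Nx; rewrite -inE. Qed.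

Lemma submod_val_linear N : linear (@submod_val R V N).
Proof. by []. Qed.
HB.instance Definition _ N :=
  GRing.isLinear.Build R (submod_type N) V _ (@submod_val R V N)
    (@submod_val_linear N).

Definition corestrict (W : lmodType R) N (f : W -> V)
    (fN : forall x, submod_set N (f x)) (x : W) : submod_type N :=
  SubmodType (mem_set (fN x)).

Lemma corestrict_linear (W : lmodType R) N (f : {linear W -> V})
  (fN : forall x, submod_set N (f x)) : linear (corestrict fN).
Proof. by move=> a u v; apply: val_inj; rewrite /= linearP. Qed.
HB.instance Definition _ (W : lmodType R) N (f : {linear W -> V})
    (fN : forall x, submod_set N (f x)) :=
  GRing.isLinear.Build R W (submod_type N) _ (corestrict fN)
    (corestrict_linear fN).

End SubmoduleBasics.

(** * The map out of a direct sum given by a family of endomorphisms *)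

Section DirectSum.
Variables (R : pzRingType) (M : lmodType R).
Variables (I : Type) (h : I -> {linear M -> M}).

(** [{classic I}] makes the arbitrary index type a [choiceType]. *)
Definition dsum_map (s : dsum M I) : M :=
  \sum_(i \in [set: {classic I}]) h i (submod_val s i).

(** Computing with [dsum_map] requires sums over one finite set of indices
    common to several families, hence the freedom in the choice of [D]. *)
Lemma dsum_mapE (s : dsum M I) (D : set {classic I}) :
  finite_set D -> (forall i, submod_val s i != 0 -> D i) ->
  dsum_map s = \sum_(i <- fset_set D) h i (submod_val s i).
Proof.
move=> finD sD; rewrite /dsum_map -(fsbig_finite _ _ finD).
apply/esym/fsbig_widen => // i [_ /= nDi].
have [->|/sD//] := eqVneq (submod_val s i) 0; exact: linear0.
Qed.

Lemma dsum_map_linear : linear dsum_map.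
Proof.
move=> a u v.
set supp := fun w : dsum M I => [set i : {classic I} | submod_val w i != 0].
have fins w : finite_set (supp w) := submod_valP w.
have finD : finite_set (supp u `|` supp v) by rewrite finite_setU.
rewrite (dsum_mapE finD (s := u)); last by left.
rewrite (dsum_mapE finD (s := v)); last by right.
rewrite (dsum_mapE finD) => [|i]; last first.
  have -> : submod_val (a *: u + v) i = a *: submod_val u i + submod_val v i.
    by [].
  have [u0|] := eqVneq (submod_val u i) 0; last by left.
  by rewrite u0 scaler0 add0r; right.
rewrite scaler_sumr -big_split; apply: eq_bigr => i _ /=; exact: linearP.
Qed.
HB.instance Definition _ :=
  GRing.isLinear.Build R (dsum M I) M _ dsum_map dsum_map_linear.

Lemma dsum_map_sub (N : submod M) (s : dsum M I) :
  (forall i, submod_set N (h i (submod_val s i))) -> submod_set N (dsum_map s).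
Proof.
move=> Ns; rewrite (dsum_mapE (submod_valP s)) //.
exact: submod_sum.
Qed.

Definition dsum_proj (i : I) (s : dsum M I) : M := submod_val s i.

Lemma dsum_proj_linear i : linear (dsum_proj i).
Proof. by []. Qed.
HB.instance Definition _ i :=
  GRing.isLinear.Build R (dsum M I) M _ (dsum_proj i) (dsum_proj_linear i).

Definition dsum_inj (i : I) (m : M) : I -> M :=
  fun j => if asbool (j = i) then m else 0.

Lemma dsum_inj_fin i m :
  submod_set (Submod (@dsum_subproof R M I)) (dsum_inj i m).
Proof.
apply: (@sub_finite_set _ _ [set i]); last exact: finite_set1.
by move=> j /=; rewrite /dsum_inj; case: asboolP => //; rewrite eqxx.
Qed.

Lemma dsum_map_inj i m :
  dsum_map (SubmodType (mem_set (dsum_inj_fin i m))) = h i m.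
Proof.
rewrite (dsum_mapE (finite_set1 (i : {classic I}))) => [|j] /=.
  by rewrite fset_set1 big_seq_fset1 /= /dsum_inj asboolT.
by rewrite /dsum_inj; case: asboolP => //; rewrite eqxx.
Qed.

End DirectSum.

(** * Lifting along a family of endomorphisms *)

Section Lifting.
Variables (R : pzRingType) (M : lmodType R).
Hypothesis Mproj : projective_in_sigma M.

(** The sequence to which projectivity applies is the canonical one: kernel of
    [dsum_map h], direct sum of copies of [M], image of [dsum_map h].  All three
    lie in sigma[M], the first as a submodule of the second. *)
Lemma lift_dsum (I : Type) (h : I -> {linear M -> M}) (w : {linear M -> M}) :
  (forall x, range (dsum_map h) (w x)) ->
  exists k : {linear M -> dsum M I}, forall x, dsum_map h (k x) = w x.
Proof.
move=> wT; pose B := dsum M I.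
have genB : generated M B by exists I, idfun => x; exists x.
pose T := range_submod (dsum_map h : {linear B -> M}).
have hT x : submod_set T (dsum_map h x) by exists x.
pose g : {linear B -> submod_type T} := corestrict hT.
have gT c : exists b, g b = c.
  have [b _ bc] := submod_valP c; exists b; exact: val_inj.
pose A := preimage_submod g (submod0 (submod_type T)).
pose f : {linear submod_type A -> B} := @submod_val R B A.
have fP : short_exact f g.
  split=> // [x y /val_inj//|b].
  split=> [gb0|[a <-]]; last exact: submod_valP a.
  by exists (SubmodType (mem_set (gb0 : submod_set A b))).
have sB : sigma M B by exists B => //; exists idfun.
have sA : sigma M (submod_type A).
  by exists B => //; exists f; exact: val_inj.
have sT : sigma M (submod_type T).
  by exists (submod_type T); [exists I, g|exists idfun].
pose wc : {linear M -> submod_type T} := @corestrict R M M T w wT.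
have [_ _ /(_ wc)[k kw]] := Mproj sA sB sT fP.
by exists k => x; have /(congr1 (@submod_val _ _ _)) := kw x.
Qed.

End Lifting.

(** * Annihilators and primes *)

Section Annihilators.
Variables (R : pzRingType) (M : lmodType R).
Implicit Types K L N P U W : submod M.

Lemma common_kernel_subproof (H : set {linear M -> M}) :
  submod_closed (mem (\bigcap_(f in H) Defs.lker f)).
Proof.
split=> [|a u v]; rewrite !inE /Defs.lker /=.
  by move=> f _ /=; rewrite linear0.
by move=> fu fv f Hf /=; rewrite linearP fu// fv// scaler0 addr0.
Qed.

Definition into U : set {linear M -> M} :=
  [set f | forall x, submod_set U (f x)].

Definition ann U : submod M := Submod (common_kernel_subproof (into U)).

Lemma annP U m :
  submod_set (ann U) m <-> forall f : {linear M -> M}, into U f -> f m = 0.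
Proof. by []. Qed.

(** Maps into the submodule, seen as a module, are traded for endomorphisms of
    [M], which can be composed and compared for different submodules. *)
Lemma Ann_submod_type U : Ann (submod_type U) = ann U.
Proof.
apply/seteqP; split=> m mU f.
  move=> fU; pose g : {linear M -> submod_type U} := corestrict fU.
  by have /(congr1 (@submod_val _ _ _)) : g m = 0 := mU g I.
move=> _; apply: val_inj.
pose g : {linear M -> M} := @submod_val R M U \o f.
exact: (mU g (fun x => submod_valP (f x))).
Qed.

Lemma prodM_sub K L N :
  prodM K L `<=` N <->
  forall f k, into L f -> submod_set K k -> submod_set N (f k).
Proof.
split=> [KLN f k fL Kk|fN x [n [f [k [Kk ->]]]]].
  apply: KLN; exists 1%N, (fun=> corestrict fL), (fun=> k); split=> //.
  by rewrite big_ord1.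
apply: submod_sum => i; pose g : {linear M -> M} := @submod_val R M L \o f i.
by apply: (fN g) => // y; exact: submod_valP.
Qed.

Lemma fully_invariantP N (f : {linear M -> M}) x :
  fully_invariant N -> submod_set N x -> submod_set N (f x).
Proof. by move=> Nfi Nx; apply: (Nfi f); exists x. Qed.

Lemma fully_invariantI K L :
  fully_invariant K -> fully_invariant L -> fully_invariant (submodI K L).
Proof.
by move=> Kfi Lfi f _ [x [Kx Lx] <-]; split; apply: fully_invariantP.
Qed.

Lemma fully_invariantT : fully_invariant (submodT M).
Proof. by []. Qed.

Lemma fully_invariant_ann U : fully_invariant (ann U).
Proof.
move=> f _ [x xU <-]; apply/annP => g gU.
pose gf : {linear M -> M} := g \o f.
exact: (xU gf (fun y => gU (f y))).
Qed.

Lemma annS U W : U `<=` W -> ann W `<=` ann U.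
Proof. by move=> UW m mW f fU; apply: mW => x; apply/UW/fU. Qed.

(** K_M L lies in the intersection of [K] and [L], so primes split
    intersections as well as products. *)
Lemma prime_meet2 P K L :
  prime_in P -> fully_invariant K -> fully_invariant L ->
  K `&` L `<=` P -> K `<=` P \/ L `<=` P.
Proof.
move=> [_ _ Pprime] Kfi Lfi KLP; apply: Pprime => //; apply/prodM_sub.
by move=> f k fL Kk; apply: KLP; split; [exact: fully_invariantP|exact: fL].
Qed.

Definition meet (s : seq (submod M)) : submod M :=
  foldr (@submodI R M) (submodT M) s.

Lemma meetP (s : seq (submod M)) x :
  submod_set (meet s) x <-> forall Q, List.In Q s -> submod_set Q x.
Proof.
elim: s => [|Q s IHs] /=; first by split.
split=> [[Qx /IHs sx] N [<-//|/sx//]|sx]; split; first by apply: sx; left.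
by apply/IHs => N sN; apply: sx; right.
Qed.

Lemma fully_invariant_meet s :
  (forall Q, List.In Q s -> fully_invariant Q) -> fully_invariant (meet s).
Proof.
elim: s => [_|Q s IHs sfi] /=; first exact: fully_invariantT.
apply: fully_invariantI; first by apply: sfi; left.
by apply: IHs => N sN; apply: sfi; right.
Qed.

Lemma prime_meet P s :
  prime_in P -> (forall Q, List.In Q s -> fully_invariant Q) ->
  meet s `<=` P -> exists2 Q, List.In Q s & Q `<=` P.
Proof.
move=> Pprime; elim: s => [_ TP|Q s IHs sfi QsP].
  by have [_ []] := Pprime; apply/seteqP; split=> // x _; apply: TP.
have sfi' N : List.In N s -> fully_invariant N by move=> sN; apply: sfi; right.
have Qfi : fully_invariant Q by apply: sfi; left.
have [QP|sP] := prime_meet2 Pprime Qfi (fully_invariant_meet sfi') QsP.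
  by exists Q => //; left.
by have [N sN NP] := IHs sfi' sP; exists N => //; right.
Qed.

Lemma finite_In (s : seq (submod M)) : finite_set [set Q | List.In Q s].
Proof.
elim: s => [|Q s IHs]; first exact: finite_set0.
apply: (@sub_finite_set _ _ ([set Q] `|` [set N | List.In N s])).
  by move=> N [->|]; [left|right].
by rewrite finite_setU; split; first exact: finite_set1.
Qed.

(** A nonempty family without maximal annihilator would yield, by dependent
    choice, a strictly increasing chain of annihilators. *)
Lemma acc_max (Q : submod M -> Prop) U0 :
  acc_annihilators M -> Q U0 ->
  exists2 U, Q U & forall W, Q W -> ann U `<=` ann W -> ann W `<=` ann U.
Proof.
move=> Macc QU0; apply: contrapT => nomax.
have step (u : {U | Q U}) :
    {v : {U | Q U} | ann (sval u) `<=` ann (sval v) &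
                     ~ ann (sval v) `<=` ann (sval u)}.
  apply: cid2; apply: contrapT => nstep; apply: nomax.
  exists (sval u) => [|W QW uW]; first exact: svalP.
  by apply: contrapT => Wu; apply: nstep; exists (exist _ W QW).
pose next u := s2val (step u).
pose chain n := iter n next (exist _ U0 QU0).
have [||n /(_ n.+1 (leqnSn n)) stop] :=
  Macc (fun n => ann (sval (chain n)) : set M).
- by move=> n; eexists.
- by move=> n; exact: (s2valP (step (chain n))).
- by apply: (s2valP' (step (chain n))); rewrite [X in X `<=` _]stop.
Qed.

(** * Semiprime modules *)

Section Semiprime.
Hypothesis Msemiprime : semiprime_module M.

(** The left side says that K_M L = 0.  It makes the intersection W of [K] and
    [L] satisfy W_M W = 0, whence W = 0 by semiprimeness; conversely a map into
    [L] sends [K] into the intersection. *)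
Lemma sub_annP K L : fully_invariant K -> fully_invariant L ->
  (K `<=` ann L) <-> (K `&` L `<=` [set 0]).
Proof.
move=> Kfi Lfi; have [_ _ sp] := Msemiprime; split=> [KL|KL0 k Kk].
  apply: (sp (submodI K L)); first exact: fully_invariantI.
  apply/prodM_sub => f k fKL [Kk _].
  by apply: (KL k Kk f) => x; have [] := fKL x.
apply/annP => f fL.
by apply: KL0; split; [exact: fully_invariantP|exact: fL].
Qed.

Lemma disjoint_ann U : fully_invariant U -> ann U `&` U `<=` [set 0].
Proof. by move=> Ufi; apply/sub_annP => //; exact: fully_invariant_ann. Qed.

Lemma sub_ann_eq0 K U :
  fully_invariant U -> K `<=` U -> K `<=` ann U -> K `<=` [set 0].
Proof.
move=> Ufi KU KaU x Kx; apply: (disjoint_ann Ufi).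
by split; [exact: KaU|exact: KU].
Qed.

(** Only one inclusion is asked for since [annS] gives the other: all nonzero
    fully invariant submodules of [U] have the annihilator of [U]. *)
Definition uniform U : Prop :=
  [/\ fully_invariant U, ~ U `<=` [set 0] &
      forall W, fully_invariant W -> ~ W `<=` [set 0] -> W `<=` U ->
        ann W `<=` ann U].

(** If [L] meets [U], the intersection has the annihilator of [U], so it is
    enough that [K] annihilates the intersection: a map into it sends [K] into
    K_M L, hence into [ann U], and into [U]. *)
Lemma uniform_prime U : uniform U -> prime_in (ann U).
Proof.
move=> [Ufi Un0 Uunif]; split; first exact: fully_invariant_ann.
  by move=> annT; apply/Un0/(sub_ann_eq0 Ufi) => // x _; rewrite annT.
move=> K L Kfi Lfi /prodM_sub KL.
have [LU|LU] := pselect (L `&` U `<=` [set 0]); first by right; apply/sub_annP.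
left=> k Kk; have LUU : submodI L U `<=` U by move=> x [].
apply: (Uunif _ (fully_invariantI Lfi Ufi) LU LUU) => f fLU.
apply: (disjoint_ann Ufi); split; last by have [] := fLU k.
by apply: KL => // x; have [] := fLU x.
Qed.

(** A prime inside [ann U] contains the zero intersection of [ann U] and [U].
    It cannot contain [U]: otherwise [U] would be inside [ann U], hence zero,
    and [ann U] would be all of [M]. *)
Lemma ann_minimal_prime U :
  fully_invariant U -> prime_in (ann U) -> minimal_prime_in (ann U).
Proof.
move=> Ufi Uprime; split=> // Q Qprime QU; apply/submod_eqP/seteqP; split=> //.
have [|//|UQ] := prime_meet2 Qprime (@fully_invariant_ann U) Ufi.
  by move=> x /(disjoint_ann Ufi) ->; exact: submod_mem0.
have U0 : U `<=` [set 0] by apply: (sub_ann_eq0 Ufi) => // x /UQ/QU.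
have [_ []] := Uprime; apply/seteqP; split=> // x _; apply/annP => f fU.
exact/U0/fU.
Qed.

(** * The ascending chain condition *)

Section FiniteAnnihilators.
Hypothesis Macc : acc_annihilators M.

(** Annihilators grow as submodules shrink, so a submodule of [U] with maximal
    annihilator is uniform. *)
Lemma exists_uniform U : fully_invariant U -> ~ U `<=` [set 0] ->
  exists2 W, uniform W & W `<=` U.
Proof.
move=> Ufi Un0.
have [|W [Wfi Wn0 WU] Wmax] := @acc_max
  (fun W => [/\ fully_invariant W, ~ W `<=` [set 0] & W `<=` U]) U Macc.
  by split.
exists W => //; split=> // V Vfi Vn0 VW; apply: Wmax; last exact: annS.
by split=> //; exact: subset_trans WU.
Qed.

(** A finite intersection with maximal annihilator is zero: if it contained a
    uniform [U], intersecting it with [ann U] would put [U] into the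
    annihilator, hence into the annihilator of a submodule containing [U]. *)
Lemma uniform_anns_meet0 : exists2 s : seq (submod M),
  (forall Q, List.In Q s -> exists2 U, uniform U & Q = ann U) &
  meet s `<=` [set 0].
Proof.
pose good s :=
  forall Q : submod M, List.In Q s -> exists2 U, uniform U & Q = ann U.
have goodfi s : good s -> fully_invariant (meet s).
  move=> sgood; apply: fully_invariant_meet => Q /sgood[U _ ->].
  exact: fully_invariant_ann.
have [|_ [s sgood ->] smax] := @acc_max
  (fun B => exists2 s, good s & B = meet s) (submodT M) Macc.
  by exists [::].
exists s => //; apply: contrapT => sn0.
have sfi := goodfi s sgood.
have [U Uunif Us] := exists_uniform sfi sn0; have [Ufi Un0 _] := Uunif.
have s'good : good (ann U :: s) by move=> Q [<-|/sgood//]; exists U.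
apply/Un0/(sub_ann_eq0 sfi) => //.
have annU : U `<=` ann (meet (ann U :: s)).
  apply/sub_annP; [done|exact: goodfi|].
  by move=> x [Ux [aUx _]]; apply: (disjoint_ann Ufi).
apply: subset_trans annU (smax _ _ _); first by exists (ann U :: s).
by apply: annS => x [].
Qed.

(** Every prime contains the zero intersection of the list just found, hence
    one of its members; so the list exhausts the minimal primes. *)
Lemma minimal_primes_seq : exists s : seq (submod M),
  [/\ forall Q, minimal_prime_in Q <-> List.In Q s,
      forall Q, List.In Q s -> annihilator_submod Q &
      meet s `<=` [set 0]].
Proof.
have [s sunif s0] := uniform_anns_meet0.
have smin Q : List.In Q s -> minimal_prime_in Q.
  move=> /sunif[U Uunif ->]; apply: ann_minimal_prime; first by case: Uunif.
  exact: uniform_prime.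
exists s; split=> // [Q|Q /sunif[U _ ->]]; last first.
  by exists U; rewrite Ann_submod_type.
split=> [[Qprime Qmin]|/smin//].
have [||N sN NQ] := prime_meet Qprime (s := s).
- by move=> N /smin[[]].
- by move=> x /s0 ->; exact: submod_mem0.
- by rewrite -(Qmin N) //; have [] := smin N sN.
Qed.

End FiniteAnnihilators.
End Semiprime.

(** * Annihilators of arbitrary submodules *)

(** [T] is the sum of the images of the endomorphisms that kill [ann K].  It is
    fully invariant because composing on the left preserves killing.  Maps into
    [K] kill [ann K], so their images lie in [T] and [ann T] is inside
    [ann K].  Conversely a map into [T] lifts to the direct sum, and each
    component of the lift preserves the fully invariant [ann K], which the
    endomorphism of that index then kills. *)
Lemma ann_of_fully_invariant K : projective_in_sigma M ->
  exists2 T, fully_invariant T & ann T = ann K.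
Proof.
move=> Mproj.
pose I := {h : {linear M -> M} | forall x, submod_set (ann K) x -> h x = 0}.
pose h (i : I) := sval i.
pose T := range_submod (dsum_map h : {linear dsum M I -> M}).
have hT i m : submod_set T (h i m).
  by rewrite -dsum_map_inj; exists (SubmodType (mem_set (dsum_inj_fin i m))).
exists T.
  move=> g _ [_ [s _ <-] <-].
  apply: (@dsum_map_sub _ _ _ h (preimage_submod g T)) => i /=.
  have ghK x : submod_set (ann K) x -> g (h i x) = 0.
    by move=> /(svalP i) /= hx; rewrite /h hx linear0.
  pose gh : {linear M -> M} := g \o h i.
  exact: (hT (exist _ gh ghK)).
apply/submod_eqP/seteqP; split=> m.
  move=> mT f fK.
  have fI x : submod_set (ann K) x -> f x = 0 by move=> /annP; apply.
  by apply: mT => x; apply: (hT (exist _ f fI)).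
move=> mK w wT; have [k kw] := lift_dsum Mproj wT.
rewrite /Defs.lker /= -kw.
apply: (@dsum_map_sub _ _ _ h (submod0 M)) => i.
apply: (svalP i); pose ki : {linear M -> M} := dsum_proj i \o k.
exact: (fully_invariantP ki (@fully_invariant_ann K)).
Qed.
End Annihilators.

Theorem theorem2p2 (R : pzRingType) (M : lmodType R)
  (Mproj : projective_in_sigma M)
  (Msemiprime : semiprime_module M)
  (Macc : acc_annihilators M) :
  [/\ finite_set [set P : submod M | minimal_prime_in P],
      forall (n : nat) (P : 'I_n -> submod M),
        injective P ->
        (forall Q : submod M, minimal_prime_in Q <-> exists i, P i = Q) ->
        \bigcap_(i in [set: 'I_n]) (P i : set M) = [set 0] &
      forall P : submod M, prime_in P ->
        (minimal_prime_in P <-> annihilator_submod P)].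
Proof.
have [s [smin sann s0]] := minimal_primes_seq Msemiprime Macc.
split=> [|n P _ Pmin|P Pprime].
- by apply: sub_finite_set (finite_In s) => Q /smin.
- apply/seteqP; split=> [x Px|_ -> i _]; last exact: submod_mem0.
  by apply/s0/meetP => Q /smin/Pmin[i <-]; apply: Px.
- split=> [/smin/sann//|[K PK]].
  have [T Tfi TK] := ann_of_fully_invariant K Mproj.
  have PT : P = ann T.
    by rewrite TK; apply/submod_eqP; rewrite PK Ann_submod_type.
  by rewrite PT in Pprime *; exact: ann_minimal_prime.
Qed.
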